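(* For every nonnegative integer $n$ and every integer $\alpha\ge 4$, $$\overline{A}_{5^\alpha}(625n+125)\equiv 0 \pmod{5}\quad\text{and}\quad \overline{A}_{5^\alpha}(625n+500)\equiv 0 \pmod{5}.$$
   Context: An overpartition of $n$ is a partition of $n$ in which the first occurrence of each distinct part may be overlined. For a positive integer $\ell$, $\overline{A}_\ell(n)$ denotes the number of overpartitions of $n$ into parts not divisible by $\ell$, with $\overline{A}_\ell(0)=1$; equivalently $$\sum_{n\ge 0}\overline{A}_\ell(n)q^n=\frac{(q^\ell;q^\ell)_\infty^2(q^2;q^2)_\infty}{(q;q)_\infty^2(q^{2\ell};q^{2\ell})_\infty},\qquad (a;q)_\infty=\prod_{k\ge 0}(1-aq^k).$$ *)

(* Defs.v *)
From mathcomp Require Import all_boot.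

Set Implicit Arguments.
Unset Strict Implicit.
Unset Printing Implicit Defensive.

(* A partition of [n] is encoded by its multiplicity function: [m i] is the
   number of parts equal to [i].  All parts are positive, so both parts and
   multiplicities are at most [n]. *)
Definition is_partition (n : nat) (m : {ffun 'I_n.+1 -> 'I_n.+1}) : bool :=
  (m ord0 == 0 :> nat) && (\sum_(i < n.+1) i * m i == n).

(* Only the first occurrence of each distinct part may be overlined, so a
   choice of overlines is a set [o] of parts that occur. *)
Definition is_overpartition (n : nat)
    (p : {ffun 'I_n.+1 -> 'I_n.+1} * {set 'I_n.+1}) : bool :=
  let: (m, o) := p in is_partition m && [forall i in o, 0 < m i].

Definition overpartitions (n : nat) :
    {set {ffun 'I_n.+1 -> 'I_n.+1} * {set 'I_n.+1}} :=
  [set p | is_overpartition p].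

Definition Abar (l n : nat) : nat :=
  #|[set p in overpartitions n | [forall i, (0 < p.1 i) ==> ~~ (l %| i)]]|.

(* Main.v *)
Require Import Defs.
From mathcomp Require Import all_boot all_algebra.
From mathcomp Require Import zify ring.

(** Write phi for the theta series of the squares, with [X] replaced by [- X] so
that all its coefficients are nonnegative.  Gauss' identity gives the generating
function of [Abar l] as phi(X^l) / phi(X).  Over F_5 this is
phi(X^l) phi(X)^4 / phi(X^5), and the operator U keeping the coefficients of
exponent divisible by 5 can be applied repeatedly.  Splitting phi = A0 + A1 + A4
by the residue of the exponent mod 5, the single identity
A0^2 + A1 A4 = phi(X^5)^2, a bijection on Gaussian integers, yields mod 5
U phi^4 = phi^4, U phi^3 = phi(X^5) phi^2 and U phi^2 = 2 phi^2 - phi(X^5)^2.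
Hence U^3 of the generating function is
phi(X^(l/125)) phi (2 phi^2 - phi(X^5)^2), whose coefficients in the residue
classes 1 and 4 mod 5 are multiples of 5.  Power series are represented by
polynomials compared up to a given exponent. *)

Set Implicit Arguments.
Unset Strict Implicit.
Unset Printing Implicit Defensive.

Import GRing.Theory.
Local Open Scope ring_scope.

(** * Gauss' theta identity in a finite form *)

Section Gauss.
Variables (R : comNzRingType) (q : R).

Definition theta_partial n := 1 + 2 * \sum_(k < n) (-1) ^+ k.+1 * q ^+ (k.+1 ^ 2).

(** [E] is the summand of the finite identity and [B] its telescoping certificate in [s]. For
    [s > 0] the factor [k = 0] of the first product is 2, the coefficient of the theta terms. *)
Let E n s := (-1) ^+ s * q ^+ (s * n.+1) * (\prod_(k < s) (1 + q ^+ k))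
  * \prod_(s <= k < n) (1 - q ^+ k.+1).
Let B n s := (-1) ^+ s * q ^+ (s * n) * (\prod_(k < s) (1 + q ^+ k))
  * \prod_(s <= k < n) (1 - q ^+ k).

Lemma shanks_step n s : (s <= n)%N ->
  E n.+1 s - (1 + q ^+ n.+1) * E n s = B n.+1 s.+1 - B n.+1 s.
Proof.
move=> sn; rewrite /E /B.
rewrite big_nat_recr //= [\prod_(s <= k < n.+1) (1 - q ^+ k)]big_nat_recl //=.
rewrite [\prod_(s.+1 <= k < n.+1) (1 - q ^+ k)]big_add1 /= big_ord_recr /=.
rewrite !mulSn !mulnS !exprS !exprD.
ring.
Qed.

(* Shanks' finite form of Gauss' identity: every term with s > 0 on the right is
   divisible by q^(n+1). *)
Lemma shanks n :
  theta_partial n * \prod_(k < n) (1 + q ^+ k.+1) = \sum_(s < n.+1) E n s.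
Proof.
elim: n => [|n IH].
  by rewrite /theta_partial /E big_ord_recl !big_ord0 big_geq //= !expr0; ring.
rewrite [RHS]big_ord_recr /=.
have -> : \sum_(s < n.+1) E n.+1 s =
    (1 + q ^+ n.+1) * (\sum_(s < n.+1) E n s) + (B n.+1 n.+1 - B n.+1 0).
  rewrite -telescope_sumr // big_mkord mulr_sumr -big_split /=.
  apply: eq_bigr => s _; rewrite -shanks_step; last by rewrite -ltnS.
  by rewrite addrC subrK.
(* [B n.+1 0] vanishes through its factor [1 - q ^+ 0]. The exponents (n+1)^2 of [B n.+1 n.+1] and
   (n+1)(n+2) of [E n.+1 n.+1] differ by n+1, so their sum is the new theta term times the enlarged
   product. *)
rewrite -IH /theta_partial big_ord_recr /= [\prod_(k < n.+1) _]big_ord_recr /=.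
rewrite /B /E ![\prod_(n.+1 <= k < _) _]big_geq // big_nat_recl //.
rewrite [\prod_(k < n.+1) (1 + q ^+ k)]big_ord_recl /=.
rewrite [\prod_(i < n) (1 + q ^+ bump 0 i)](_ : _ = \prod_(i < n) (1 + q ^+ i.+1)) //.
rewrite (mulnS n.+1 n.+1) -mulnn exprD expr0; ring.
Qed.
End Gauss.

(** * Power series modulo X^(N+1) *)

Section Truncation.
Variable R : comNzRingType.
Implicit Types p q r f : {poly R}.

Definition eqcoef (N : nat) p q := forall i, (i <= N)%N -> p`_i = q`_i.

Lemma eqcoef_refl N p : eqcoef N p p. Proof. by []. Qed.

Lemma eqcoef_sym N p q : eqcoef N p q -> eqcoef N q p.
Proof. by move=> h i /h. Qed.

Lemma eqcoef_trans N q p r : eqcoef N p q -> eqcoef N q r -> eqcoef N p r.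
Proof. by move=> h1 h2 i iN; rewrite h1 // h2. Qed.

Lemma eqcoef_le N M p q : (M <= N)%N -> eqcoef N p q -> eqcoef M p q.
Proof. by move=> MN h i iM; apply: h; apply: leq_trans MN. Qed.

Lemma eqcoefD N p1 q1 p2 q2 :
  eqcoef N p1 q1 -> eqcoef N p2 q2 -> eqcoef N (p1 + p2) (q1 + q2).
Proof. by move=> h1 h2 i iN; rewrite !coefD h1 // h2. Qed.

Lemma eqcoefN N p q : eqcoef N p q -> eqcoef N (- p) (- q).
Proof. by move=> h i iN; rewrite !coefN h. Qed.

Lemma eqcoefM N p1 q1 p2 q2 :
  eqcoef N p1 q1 -> eqcoef N p2 q2 -> eqcoef N (p1 * p2) (q1 * q2).
Proof.
move=> h1 h2 i iN; rewrite !coefM; apply: eq_bigr => j _.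
by rewrite h1 ?h2 //; have := ltn_ord j; lia.
Qed.

Lemma eqcoef_sum0 N (I : Type) (s : seq I) (P : pred I) (F : I -> {poly R}) :
  (forall i, P i -> eqcoef N (F i) 0) -> eqcoef N (\sum_(i <- s | P i) F i) 0.
Proof.
move=> h; apply: (big_ind (fun p => eqcoef N p 0)) => // p q hp hq.
by rewrite -[X in eqcoef N _ X]addr0; apply: eqcoefD.
Qed.

Lemma eqcoef_prod N (I : Type) (s : seq I) (P : pred I) (F G : I -> {poly R}) :
  (forall i, P i -> eqcoef N (F i) (G i)) ->
  eqcoef N (\prod_(i <- s | P i) F i) (\prod_(i <- s | P i) G i).
Proof. by move=> h; apply: (big_ind2 (eqcoef N)) => // *; apply: eqcoefM. Qed.

Lemma eqcoef_cancel N f p q : f`_0 = 1 ->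
  eqcoef N (p * f) (q * f) -> eqcoef N p q.
Proof.
move=> f0 h i; elim/ltn_ind: i => i IH iN.
have := h i iN; rewrite !coefM !big_ord_recr /= subnn f0 !mulr1.
rewrite (eq_bigr (fun j : 'I_i => q`_j * f`_(i - j))) ?(addrI _) //.
  by move/addrI.
by move=> j _; rewrite IH //; have := ltn_ord j; lia.
Qed.

Lemma eqcoef_signX N k p : (N < k)%N -> eqcoef N ((- 'X) ^+ k * p) 0.
Proof.
move=> Nk i iN; rewrite exprNn mulrAC coefMXn.
by rewrite (leq_ltn_trans iN Nk) coef0.
Qed.

Lemma coef0_signX k : (0 < k)%N -> ((- 'X : {poly R}) ^+ k)`_0 = 0.
Proof. by case: k => // k _; rewrite exprS mulNr coefN coefXM oppr0. Qed.

End Truncation.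

(** * The operator U and residues of exponents mod 5 *)

Section Sections5.
Variable R : comNzRingType.
Implicit Types p q : {poly R}.

Definition sect5 p := \poly_(i < size p) p`_(5 * i).

Lemma coef_sect5 p i : (sect5 p)`_i = p`_(5 * i).
Proof.
rewrite coef_poly; case: ltnP => // h.
by rewrite nth_default //; apply: leq_trans h (leq_pmull _ _).
Qed.

Lemma sect5D p q : sect5 (p + q) = sect5 p + sect5 q.
Proof. by apply/polyP=> i; rewrite !(coef_sect5, coefD). Qed.

Lemma sect5MXn p : sect5 (p * 'X^5) = sect5 p * 'X.
Proof.
apply/polyP=> i; rewrite coefMX !coef_sect5 coefMXn.
case: i => [|i]; first by [].
by rewrite ifF; [congr (_ `_ _)|]; lia.
Qed.

(** U is linear over series in X^5; Horner induction on [q] reduces this to the factor X^5. *)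
Lemma sect5_mul_comp p q : sect5 (p * (q \Po 'X^5)) = sect5 p * q.
Proof.
elim/poly_ind: q => [|q c IH].
  by rewrite comp_poly0 !mulr0; apply/polyP=> i; rewrite coef_sect5 !coef0.
rewrite comp_polyD comp_polyM comp_polyX comp_polyC !mulrDr.
rewrite sect5D [p * (_ * _)]mulrA sect5MXn IH -mulrA; congr (_ + _).
by apply/polyP=> i; rewrite coef_sect5 !coefMC coef_sect5.
Qed.

(** Each application of U divides the available precision by 5. *)
Lemma eqcoef_sect5 N p q : eqcoef (5 * N) p q -> eqcoef N (sect5 p) (sect5 q).
Proof. by move=> h i iN; rewrite !coef_sect5 h //; lia. Qed.

Lemma eqcoef_sect5_comp N p q :
  eqcoef (5 * N) p (q \Po 'X^5) -> eqcoef N (sect5 p) q.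
Proof.
move=> h i iN; rewrite coef_sect5 h ?leq_mul2l ?iN ?orbT //.
by rewrite coef_comp_poly_Xn // dvdn_mulr // mulKn.
Qed.

Definition inres (r : nat) p := forall i, (i != r %[mod 5])%N -> p`_i = 0.

Lemma inresM r s p q : inres r p -> inres s q -> inres (r + s) (p * q).
Proof.
move=> h1 h2 i irs; rewrite coefM big1 // => j _.
case: (eqVneq (j %% 5) (r %% 5))%N => hj; last by rewrite h1 ?mul0r.
by rewrite h2 ?mulr0 //; have := ltn_ord j; move: irs hj; lia.
Qed.

Lemma inres1 : inres 0 1.
Proof. by move=> [|i] //; rewrite coef1. Qed.

Lemma inresX r p n : inres r p -> inres (r * n) (p ^+ n).
Proof.
move=> h; elim: n => [|n IH]; first by rewrite muln0; exact: inres1.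
by rewrite exprS mulnS; apply: inresM.
Qed.

Lemma inres_comp p : inres 0 (p \Po 'X^5).
Proof. by move=> i; rewrite coef_comp_poly_Xn //; case: ifP => //; lia. Qed.

Lemma sect5_res r p : (r %% 5 != 0)%N -> inres r p -> sect5 p = 0.
Proof. by move=> r0 h; apply/polyP=> i; rewrite coef_sect5 coef0 h //; lia. Qed.

End Sections5.

(** * Lattice points and representation counts *)

Fixpoint zrange (n : nat) : seq int :=
  if n is m.+1 then m.+1%:Z :: - m.+1%:Z :: zrange m else [:: 0].

Lemma mem_zrange n x : (x \in zrange n) = (`|x| <= n)%N.
Proof.
elim: n => [|n IH] /=; first by rewrite inE; lia.
by rewrite !inE IH; lia.
Qed.

Lemma zrange_uniq n : uniq (zrange n).
Proof. by elim: n => //= n IH; rewrite inE !mem_zrange IH; lia. Qed.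

Definition zbox n := [seq (x, y) | x <- zrange n, y <- zrange n].

Lemma mem_zbox n p : (p \in zbox n) = (`|p.1| <= n)%N && (`|p.2| <= n)%N.
Proof.
rewrite -!mem_zrange; apply/allpairsP/andP => [[[x y] [? ? ->]] //|[? ?]].
by exists p; split=> //; rewrite -surjective_pairing.
Qed.

Lemma zbox_uniq n : uniq (zbox n).
Proof. by apply: allpairs_uniq; rewrite ?zrange_uniq // => -[? ?] [? ?] _ _. Qed.

Lemma count_bij (T : eqType) (P Q : pred T) (f : T -> T) (s : seq T) :
  uniq s ->
  {in [pred x | Q x && (x \in s)] &, injective f} ->
  (forall x, x \in s -> Q x -> P (f x) && (f x \in s)) ->
  (forall y, y \in s -> P y -> exists2 x, Q x && (x \in s) & y = f x) ->
  count P s = count Q s.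
Proof.
move=> us finj fQ fP; rewrite -!size_filter -[RHS](size_map f); apply: perm_size.
apply: uniq_perm; rewrite ?filter_uniq //.
  rewrite map_inj_in_uniq ?filter_uniq // => x y.
  by rewrite !mem_filter; exact: finj.
move=> y; rewrite mem_filter; apply/andP/mapP => [[Py ys]|[x]].
  by have [x xQ ->] := fP y ys Py; exists x; rewrite ?mem_filter.
by rewrite mem_filter => /andP[Qx xs] ->; apply/andP/fQ.
Qed.

Lemma coef_sumXn (R : nzRingType) (I : Type) (s : seq I) (P : pred I)
    (a : I -> nat) n :
  (\sum_(x <- s | P x) 'X^(a x) : {poly R})`_n =
  (count [pred x | P x && (a x == n)] s)%:R.
Proof.
rewrite coef_sum -sum1_count natr_sum big_mkcondr /=.
by apply: eq_bigr => x _; rewrite coefXn eq_sym; case: eqP.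
Qed.

(** Turns identities between products of theta series into comparisons of numbers of lattice
    points. *)
Lemma coef_mul_sumXn (R : nzRingType) (I J : Type) (s : seq I) (t : seq J)
    (P : pred I) (Q : pred J) (a : I -> nat) (b : J -> nat) n :
  ((\sum_(x <- s | P x) 'X^(a x)) * (\sum_(y <- t | Q y) 'X^(b y))
     : {poly R})`_n =
  (count [pred p | P p.1 && Q p.2 && (a p.1 + b p.2 == n)%N]
     [seq (x, y) | x <- s, y <- t])%:R.
Proof.
rewrite -(@coef_sumXn _ _ _ [pred p | P p.1 && Q p.2] (fun p => a p.1 + b p.2)%N).
congr ((polyseq _)`_n); rewrite big_distrlr /= [LHS]big_mkcond [RHS]big_mkcond big_allpairs.
apply: eq_bigr => x _; case: (P x) => /=; last first.
  by rewrite big1.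
by rewrite big_mkcond; apply: eq_bigr => y _; rewrite exprD.
Qed.

(* [sq<r> x] holds when x^2 = r mod 5. *)
Definition sq0 (x : int) := (x %% 5 == 0)%Z.
Definition sq1 (x : int) := (x %% 5 == 1)%Z || (x %% 5 == 4)%Z.
Definition sq4 (x : int) := (x %% 5 == 2)%Z || (x %% 5 == 3)%Z.

Lemma sqr_absz (x : int) : (`|x| ^ 2)%N%:Z = x * x.
Proof. by nia. Qed.

Lemma eqn_norm (c n : nat) (x y : int) :
  (c * `|x| ^ 2 + c * `|y| ^ 2 == n)%N = (c%:Z * (x * x + y * y) == n%:Z).
Proof. by rewrite -eqz_nat PoszD 2!(PoszM c) !sqr_absz mulrDr. Qed.

Lemma eqn_norm1 (n : nat) (x y : int) :
  (`|x| ^ 2 + `|y| ^ 2 == n)%N = (x * x + y * y == n%:Z).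
Proof. by rewrite -eqz_nat PoszD !sqr_absz. Qed.

(** Since |x| <= x^2 for integers, the box of radius [N] contains every point of norm at most
    [N]. *)
Lemma absz_leq_norm (n N : nat) (x y : int) :
  x * x + y * y = n%:Z -> (n <= N)%N -> (`|x| <= N)%N.
Proof.
move=> e nN; have : (0 <= y * y)%R by nia.
have := sqr_absz x; move: e; move: (x * x) (y * y) => a b e ea b0.
have : (`|x| ^ 2 <= N)%N by lia.
by nia.
Qed.

(* Multiplication by 2 + i maps the Gaussian
   integers of norm m to those of norm 5m with x = 2y mod 5, and exchanging
   x and y when x^2 = -1 mod 5 turns these into the pairs counted on the left. *)
Lemma count_norm5 N n : (n <= N)%N ->
  (count [pred p | sq0 p.1 && sq0 p.2 && (`|p.1| ^ 2 + `|p.2| ^ 2 == n)%N] (zbox N)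
   + count [pred p | sq1 p.1 && sq4 p.2 && (`|p.1| ^ 2 + `|p.2| ^ 2 == n)%N] (zbox N)
  = count [pred p | true && true && (5 * `|p.1| ^ 2 + 5 * `|p.2| ^ 2 == n)%N] (zbox N))%N.
Proof.
move=> nN; rewrite -count_predUI [X in (_ + X)%N](@eq_count _ _ pred0); last first.
  by move=> [x y] /=; rewrite /sq0 /sq1; lia.
rewrite count_pred0 addn0.
(* With p = (u, v), this x + iy is (2 + i)(u - iv). *)
pose f (p : int * int) :=
  let x := 2 * p.1 + p.2 in let y := p.1 - 2 * p.2 in
  if sq4 x then (y, x) else (x, y).
apply: (@count_bij _ _ _ f); first exact: zbox_uniq.
- move=> [u v] [u' v'] _ _; rewrite /f /sq4 /=.
  (* If only one of the two images is swapped, equality would give x = 2y and y = 2x mod 5, hence x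
     = 0 mod 5, against [sq4]. *)
  by case: ifP => h1; case: ifP => h2 [e1 e2]; congr pair; lia.
- move=> [u v]; rewrite mem_zbox /f /= eqn_norm => _ /eqP e.
  have exy : (2 * u + v) * (2 * u + v) + (u - 2 * v) * (u - 2 * v) = n%:Z.
    by rewrite -e; ring.
  have xn := absz_leq_norm exy nN.
  have yn := absz_leq_norm (etrans (addrC _ _) exy) nN.
  case: ifP => hx; rewrite mem_zbox /= xn yn !andbT !eqn_norm1.
    rewrite [(u - 2 * v) * _ + _]addrC exy eqxx !andbT.
    by move: hx {e exy xn yn}; rewrite /sq0 /sq1 /sq4; lia.
  rewrite exy eqxx !andbT.
  by move: hx {e exy xn yn}; rewrite /sq0 /sq1 /sq4; lia.
- move=> [x y]; rewrite mem_zbox /= eqn_norm1 -andb_orl => _ /andP[h /eqP exy].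
  (* The linear map (u, v) -> (2u + v, u - 2v) squares to 5, so its inverse is itself divided by 5;
     the congruence makes both divisions exact. *)
  have wit (a b : int) : (a * a + b * b = n%:Z) -> (a %% 5 = (2 * b) %% 5)%Z ->
      exists u v : int, [/\ a = 2 * u + v, b = u - 2 * v
        & [&& (5 * `|u| ^ 2 + 5 * `|v| ^ 2 == n)%N, (`|u| <= N)%N & (`|v| <= N)%N]].
    move=> eab hab; exists ((2 * a + b) %/ 5)%Z, ((a - 2 * b) %/ 5)%Z.
    have : a = 2 * ((2 * a + b) %/ 5)%Z + ((a - 2 * b) %/ 5)%Z.
      by move: hab {eab exy}; lia.
    have : b = ((2 * a + b) %/ 5)%Z - 2 * ((a - 2 * b) %/ 5)%Z.
      by move: hab {eab exy}; lia.
    move: (divz (2 * a + b) 5) (divz (a - 2 * b) 5) => u v eb ea.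
    have euv : 5 * (u * u + v * v) = n%:Z by rewrite -eab ea eb; ring.
    have [m em] : exists m : nat, u * u + v * v = m%:Z.
      by exists (`|u| ^ 2 + `|v| ^ 2)%N; rewrite PoszD !sqr_absz.
    have mN : (m <= N)%N by move: euv; rewrite em; lia.
    split=> //; rewrite eqn_norm euv eqxx (absz_leq_norm em mN).
    by rewrite (absz_leq_norm (etrans (addrC _ _) em) mN).
  (* The residue classes of [x] and [y] force x = 2y or y = 2x mod 5; the second alone occurs
     exactly for the swapped images. *)
  case: (eqVneq (x %% 5)%Z ((2 * y) %% 5)%Z) => hxy.
    have [u [v [ex ey /and3P[e1 e2 e3]]]] := wit x y exy hxy.
    exists (u, v); first by rewrite mem_zbox /= e1 e2 e3.
    rewrite /f /= -ex -ey ifF //.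
    by move: h hxy {exy ex ey wit}; rewrite /sq0 /sq1 /sq4; lia.
  have hyx : (y %% 5 = (2 * x) %% 5)%Z.
    by move: h hxy {exy wit}; rewrite /sq0 /sq1 /sq4; lia.
  have [u [v [ey ex /and3P[e1 e2 e3]]]] := wit y x (etrans (addrC _ _) exy) hyx.
  exists (u, v); first by rewrite mem_zbox /= e1 e2 e3.
  rewrite /f /= -ex -ey ifT //.
  by move: h hxy {exy ex ey wit hyx}; rewrite /sq0 /sq1 /sq4; lia.
Qed.

Lemma count_sq25 N n : (n <= N)%N ->
  (count [pred x | sq0 x && (`|x| ^ 2 == n)%N] (zrange N)
  = count [pred x : int | true && (25 * `|x| ^ 2 == n)%N] (zrange N))%N.
Proof.
move=> nN; apply: (@count_bij _ _ _ (fun u => 5 * u)); first exact: zrange_uniq.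
- by move=> u v _ _ /=; lia.
- by move=> u; rewrite !mem_zrange /sq0 /= => _ /eqP e; apply/andP; split; nia.
- move=> x; rewrite mem_zrange /sq0 /= => _ /andP[h /eqP e].
  exists (x %/ 5)%Z; last by lia.
  by rewrite mem_zrange; have : x = 5 * (x %/ 5)%Z; [lia|]; nia.
Qed.

(** * Theta series over F_5 and their 5-dissection *)

Section Theta.
Variable N : nat.
Local Notation F := 'F_5.

(** A truncation of phi(X^c). Bounding the index instead of the degree makes the substitution X ->
    X^5 and the fifth power exact equalities. *)
Definition theta (c : nat) : {poly F} := \sum_(k <- zrange N) 'X^(c * `|k| ^ 2).
Definition theta_on (S : pred int) : {poly F} :=
  \sum_(k <- zrange N | S k) 'X^(`|k| ^ 2).

Local Notation phi := (theta 1).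
Local Notation A0 := (theta_on sq0).
Local Notation A1 := (theta_on sq1).
Local Notation A4 := (theta_on sq4).

Lemma five_eq0 : (5 : {poly F}) = 0.
Proof.
have h : 5 \in [pchar {poly F}] by rewrite pchar_poly pchar_Fp.
exact: pcharf0 h.
Qed.

Lemma theta_coef0 c : (0 < c)%N -> (theta c)`_0 = 1.
Proof.
move=> c0; rewrite coef_sumXn (@eq_in_count _ _ (pred1 0)).
  by rewrite count_uniq_mem ?zrange_uniq // mem_zrange.
by move=> x _ /=; rewrite muln_eq0 expn_eq0 absz_eq0; case: c c0 => // c _; rewrite andbT.
Qed.

Lemma theta_comp c : theta c \Po 'X^5 = theta (5 * c).
Proof.
rewrite /theta raddf_sum /=; apply: eq_bigr => k _.
by rewrite comp_Xn_poly -exprM mulnA.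
Qed.

(** Frobenius is additive in characteristic 5. This allows 1 / phi to be traded for phi^4 /
    phi(X^5). *)
Lemma theta_exp5 c : theta c ^+ 5 = theta (5 * c).
Proof.
have h : 5 \in [pchar {poly F}] by rewrite pchar_poly pchar_Fp.
rewrite -(pFrobenius_autE h) /theta raddf_sum /=; apply: eq_bigr => k _.
by rewrite pFrobenius_autE -exprM mulnC mulnA.
Qed.

(** For odd [c] the sign (-1)^(m + c m^2) is 1; the terms of [m] and [-m] together give the
    coefficient 2. *)
Lemma theta_partialE c : odd c -> theta c = theta_partial ((- 'X) ^+ c) N.
Proof.
move=> oc; rewrite /theta /theta_partial.
elim: N => [|n IH]; first by rewrite big_seq1 big_ord0 mulr0 addr0 muln0.
rewrite !big_cons IH big_ord_recr /= -!exprM ?abszN ?absz_nat.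
set m := n.+1; have -> : (-1) ^+ m * (- 'X) ^+ (c * m ^ 2) = 'X^(c * m ^ 2) :> {poly F}.
  rewrite [(- 'X) ^+ _]exprNn mulrA -exprD -signr_odd oddD oddM oddX oc /=.
  by rewrite addbb expr0 mul1r.
by ring.
Qed.

Lemma theta_dissect : phi = A0 + A1 + A4.
Proof.
rewrite /theta /theta_on [\sum_(k <- _ | sq0 k) _]big_mkcond.
rewrite [\sum_(k <- _ | sq1 k) _]big_mkcond [\sum_(k <- _ | sq4 k) _]big_mkcond.
rewrite -!big_split /=.
apply: eq_bigr => k _; rewrite mul1n /sq0 /sq1 /sq4.
case: eqVneq => h0; case: eqVneq => h1; case: eqVneq => h2; case: eqVneq => h3;
  case: eqVneq => h4 /=; rewrite ?add0r ?addr0 //; exfalso; move: h0 h1 h2 h3 h4; lia.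
Qed.

Lemma inres_theta_on (S : pred int) r :
  (forall x, S x -> (`|x| ^ 2 = r %[mod 5])%N) -> inres r (theta_on S).
Proof.
move=> h i ir; rewrite coef_sum big1 // => k Sk.
by rewrite coefXn; case: eqP => // e; move: ir; rewrite e (h k Sk) eqxx.
Qed.

Lemma inres_A0 : inres 0 A0.
Proof.
apply: inres_theta_on => x; rewrite /sq0 -modnXm => h.
by have -> : (`|x| %% 5)%N = 0%N by move: h; lia.
Qed.

Lemma inres_A1 : inres 1 A1.
Proof.
apply: inres_theta_on => x; rewrite /sq1 -modnXm => h.
have : ((`|x| %% 5)%N == 1%N) || ((`|x| %% 5)%N == 4%N) by move: h; lia.
by case/orP => /eqP ->.
Qed.

Lemma inres_A4 : inres 4 A4.
Proof.
apply: inres_theta_on => x; rewrite /sq4 -modnXm => h.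
have : ((`|x| %% 5)%N == 2%N) || ((`|x| %% 5)%N == 3%N) by move: h; lia.
by case/orP => /eqP ->.
Qed.

(** Both sides count lattice points by norm, and [count_norm5] matches the counts as long as the box
    misses no point. *)
Lemma theta_quad : eqcoef N (A0 * A0 + A1 * A4) (theta 5 * theta 5).
Proof.
move=> n nN; rewrite coefD !coef_mul_sumXn -natrD.
by rewrite (count_norm5 nN).
Qed.

Lemma theta_A0 : eqcoef N A0 (theta 25).
Proof. by move=> n nN; rewrite !coef_sumXn (count_sq25 nN). Qed.

Lemma inres_mono a i j : inres (i + 4 * j) (A0 ^+ a * A1 ^+ i * A4 ^+ j).
Proof.
have := inresM (inresM (@inresX _ _ _ a inres_A0) (@inresX _ _ _ i inres_A1))
  (@inresX _ _ _ j inres_A4).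
by rewrite mul0n mul1n add0n.
Qed.

(** The expansions below write each discarded monomial with a numeral, even [1%:R], and all three
    exponents, even 0, so that this one rewrite removes them all. *)
Lemma sect5_mono n a i j : ((i + 4 * j) %% 5 != 0)%N ->
  sect5 (n%:R * (A0 ^+ a * A1 ^+ i * A4 ^+ j)) = 0.
Proof.
move=> h; apply/polyP=> k; rewrite coef0 coef_sect5 mulr_natl coefMn.
by rewrite -coef_sect5 (sect5_res h (@inres_mono a i j)) coef0 mul0rn.
Qed.

(** The residue 0 part of phi^2 is A0^2 + 2 A1 A4, written as [G] to expose the quadratic identity;
    it becomes 2 phi(X^5)^2 - phi(X^25)^2. *)
Lemma sect5_theta2 M : (5 * M <= N)%N ->
  eqcoef M (sect5 (phi ^+ 2)) (2 * phi ^+ 2 - theta 5 ^+ 2).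
Proof.
move=> MN; pose G := (2 * (A0 * A0 + A1 * A4) - A0 * A0).
have e : phi ^+ 2 = G
   + (2 * (A0 ^+ 1 * A1 ^+ 1 * A4 ^+ 0)) + (2 * (A0 ^+ 1 * A1 ^+ 0 * A4 ^+ 1))
   + 1%:R * (A0 ^+ 0 * A1 ^+ 2 * A4 ^+ 0) + 1%:R * (A0 ^+ 0 * A1 ^+ 0 * A4 ^+ 2).
  by rewrite theta_dissect /G; ring.
rewrite [in sect5 _]e !sect5D !sect5_mono // !addr0 -?sect5D.
apply: eqcoef_sect5_comp; rewrite rmorphB rmorphM !rmorphXn rmorph_nat /= !theta_comp.
apply: eqcoef_le MN _; rewrite expr2; apply: eqcoefD.
  by apply: eqcoefM => //; exact: theta_quad.
by apply: eqcoefN; rewrite expr2; exact: eqcoefM theta_A0 theta_A0.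
Qed.

(** The residue 0 part is A0^3 + 6 A0 A1 A4, and 6 = 1 mod 5 brings out the factor A0^2 + A1 A4. *)
Lemma sect5_theta3 M : (5 * M <= N)%N ->
  eqcoef M (sect5 (phi ^+ 3)) (theta 5 * phi ^+ 2).
Proof.
move=> MN; pose G := A0 * (A0 * A0 + A1 * A4) + 5 * (A0 * A1 * A4).
have e : phi ^+ 3 = G
   + 3 * (A0 ^+ 2 * A1 ^+ 1 * A4 ^+ 0) + 3 * (A0 ^+ 2 * A1 ^+ 0 * A4 ^+ 1)
   + 3 * (A0 ^+ 1 * A1 ^+ 2 * A4 ^+ 0) + 3 * (A0 ^+ 1 * A1 ^+ 0 * A4 ^+ 2)
   + 3 * (A0 ^+ 0 * A1 ^+ 2 * A4 ^+ 1) + 3 * (A0 ^+ 0 * A1 ^+ 1 * A4 ^+ 2)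
   + 1%:R * (A0 ^+ 0 * A1 ^+ 3 * A4 ^+ 0) + 1%:R * (A0 ^+ 0 * A1 ^+ 0 * A4 ^+ 3).
  by rewrite theta_dissect /G; ring.
rewrite [in sect5 _]e !sect5D !sect5_mono // !addr0 -?sect5D five_eq0 mul0r addr0.
apply: eqcoef_sect5_comp; rewrite rmorphM rmorphXn /= !theta_comp.
apply: eqcoef_le MN _; rewrite expr2.
by apply: eqcoefM; [exact: theta_A0 | exact: theta_quad].
Qed.

(** The residue 0 part A0^4 + 12 A0^2 A1 A4 + 6 A1^2 A4^2 is the square of A0^2 + A1 A4 mod 5. *)
Lemma sect5_theta4 M : (5 * M <= N)%N ->
  eqcoef M (sect5 (phi ^+ 4)) (phi ^+ 4).
Proof.
move=> MN; pose G := (A0 * A0 + A1 * A4) * (A0 * A0 + A1 * A4)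
   + 5 * (2 * (A0 * A0 * A1 * A4) + A1 ^+ 2 * A4 ^+ 2).
have e : phi ^+ 4 = G
   + 4 * (A0 ^+ 3 * A1 ^+ 1 * A4 ^+ 0) + 4 * (A0 ^+ 3 * A1 ^+ 0 * A4 ^+ 1)
   + 6 * (A0 ^+ 2 * A1 ^+ 2 * A4 ^+ 0) + 6 * (A0 ^+ 2 * A1 ^+ 0 * A4 ^+ 2)
   + 12 * (A0 ^+ 1 * A1 ^+ 2 * A4 ^+ 1) + 12 * (A0 ^+ 1 * A1 ^+ 1 * A4 ^+ 2)
   + 4 * (A0 ^+ 1 * A1 ^+ 3 * A4 ^+ 0) + 4 * (A0 ^+ 1 * A1 ^+ 0 * A4 ^+ 3)
   + 4 * (A0 ^+ 0 * A1 ^+ 3 * A4 ^+ 1) + 4 * (A0 ^+ 0 * A1 ^+ 1 * A4 ^+ 3)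
   + 1%:R * (A0 ^+ 0 * A1 ^+ 4 * A4 ^+ 0) + 1%:R * (A0 ^+ 0 * A1 ^+ 0 * A4 ^+ 4).
  by rewrite theta_dissect /G; ring.
rewrite [in sect5 _]e !sect5D !sect5_mono // !addr0 -?sect5D five_eq0 mul0r addr0.
apply: eqcoef_sect5_comp; rewrite rmorphXn /= !theta_comp.
apply: eqcoef_le MN _.
have -> : theta 5 ^+ 4 = (theta 5 * theta 5) * (theta 5 * theta 5) by ring.
by apply: eqcoefM; exact: theta_quad.
Qed.

(* The residues 1 and 4 of phi^3 are 3 A1 phi(X^5)^2 and 3 A4 phi(X^5)^2. *)
Lemma theta_vanish i : (i <= N)%N -> (i %% 5 == 1)%N || (i %% 5 == 4)%N ->
  forall p, ((p \Po 'X^5) * (phi * (2 * phi ^+ 2 - theta 5 ^+ 2)))`_i = 0.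
Proof.
move=> iN ri p; pose Q := A0 * A0 + A1 * A4.
have h : eqcoef N (phi * (2 * phi ^+ 2 - theta 5 ^+ 2))
   (2 * phi ^+ 3 - phi * Q).
  have -> : phi * (2 * phi ^+ 2 - theta 5 ^+ 2) =
    2 * phi ^+ 3 - phi * (theta 5 * theta 5) by ring.
  apply: eqcoefD => //; apply: eqcoefN; apply: eqcoefM => //.
  by apply: eqcoef_sym; exact: theta_quad.
have {h} := eqcoefM (@eqcoef_refl _ N (p \Po 'X^5)) h => -> //.
(* In residues 1 and 4 the coefficient of [A1 * Q] and [A4 * Q] is 2 * 3 - 1 = 5; the other groups
   have residues 0, 2 and 3. *)
have -> : 2 * phi ^+ 3 - phi * Q =
    5 * ((A1 + A4) * Q)
   + ((1%:R * (A0 ^+ 3 * A1 ^+ 0 * A4 ^+ 0) + 11%:R * (A0 ^+ 1 * A1 ^+ 1 * A4 ^+ 1))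
   + (6 * (A0 ^+ 1 * A1 ^+ 2 * A4 ^+ 0) + 2 * (A0 ^+ 0 * A1 ^+ 0 * A4 ^+ 3))
   + (6 * (A0 ^+ 1 * A1 ^+ 0 * A4 ^+ 2) + 2 * (A0 ^+ 0 * A1 ^+ 3 * A4 ^+ 0))).
  by rewrite theta_dissect /Q; ring.
rewrite five_eq0 mul0r add0r !mulrDr !coefD.
have z n a j k : ((j + 4 * k) %% 5 \in [:: 0; 2; 3])%N ->
    ((p \Po 'X^5) * (n%:R * (A0 ^+ a * A1 ^+ j * A4 ^+ k)))`_i = 0.
  move=> hjk; rewrite mulrCA mulr_natl coefMn.
  rewrite (inresM (@inres_comp _ p) (@inres_mono a j k)) ?mul0rn // add0n.
  by move: ri hjk; rewrite !inE; lia.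
by rewrite !z // !addr0.
Qed.
End Theta.

(** * The generating function of overpartitions, at -X *)

Lemma coef_signX (R : comNzRingType) k n :
  ((- 'X : {poly R}) ^+ k)`_n = if k == n then (-1) ^+ n else 0.
Proof.
have -> : - 'X = (-1)%:P * 'X :> {poly R} by rewrite polyCN mulN1r.
rewrite exprMn -polyC_exp coefCM coefXn eq_sym.
by case: eqP => [->|_]; rewrite ?mulr1 ?mulr0.
Qed.

(** The number of ways in which [i] can occur [j] times: absent, forbidden, or with its first
    occurrence overlined or not. *)
Definition weight (l i j : nat) : nat :=
  (if j == 0 then 1 else if l %| i then 0 else 2)%N.

(** For a fixed [m] the overline sets are the subsets of its support, 2 choices per part. The
    requirement [m ord0 = 0] is enforced by the weight, as [l] divides 0. *)
Lemma Abar_weight l n :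
  Abar l n = (\sum_(m : {ffun 'I_n.+1 -> 'I_n.+1} | \sum_(i < n.+1) i * m i == n)
                \prod_(i < n.+1) weight l i (m i))%N.
Proof.
pose supp (m : {ffun 'I_n.+1 -> 'I_n.+1}) := [set i | (0 < m i)%N].
pose good (m : {ffun 'I_n.+1 -> 'I_n.+1}) :=
  [forall i, (0 < m i)%N ==> ~~ (l %| i)%N].
have -> : Abar l n = (\sum_(m | is_partition m && good m) 2 ^ #|supp m|)%N.
  rewrite /Abar -sum1_card.
  rewrite (eq_bigl (fun p : {ffun 'I_n.+1 -> 'I_n.+1} * {set 'I_n.+1} =>
    (is_partition p.1 && good p.1) && (p.2 \subset supp p.1))).
    rewrite -(pair_big_dep (fun m => is_partition m && good m)
      (fun m (o : {set 'I_n.+1}) => o \subset supp m) (fun _ _ => 1%N)) /=.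
    apply: eq_bigr => m _; rewrite sum1dep_card -card_powerset.
    by apply: eq_card => o; rewrite !inE.
  move=> [m o]; rewrite !inE /= andbAC; congr (_ && _).
  apply/forall_inP/subsetP => h i io; have := h i io.
    by rewrite inE.
  by rewrite inE.
rewrite big_mkcond [RHS]big_mkcond; apply: eq_bigr => m _.
rewrite /is_partition; case: (_ == n); last by rewrite andbF.
rewrite andbT; case: (boolP (good m)) => [/forallP gm|bm].
  rewrite andbT ifT; last by have := gm ord0; rewrite dvdn0 implybF -eqn0Ngt.
  rewrite -prod_nat_const big_mkcond; apply: eq_bigr => i _.
  rewrite inE /weight lt0n; have := gm i; rewrite lt0n.
  by case: eqP => //= _; case: (l %| i)%N.
rewrite andbF; move: bm; rewrite negb_forall => /existsP[i].
rewrite negb_imply negbK lt0n => /andP[m0 li].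
by rewrite (bigD1 i) //= /weight (negPf m0) li mul0n.
Qed.

Definition overgf (l N : nat) : {poly 'F_5} :=
  \prod_(i < N.+1) \sum_(j < N.+1) (weight l i j)%:R * (- 'X) ^+ (i * j).

Lemma coef_overgf l N : (overgf l N)`_N = (-1) ^+ N * (Abar l N)%:R.
Proof.
rewrite /overgf bigA_distr_bigA /= coef_sum Abar_weight natr_sum mulr_sumr.
rewrite [RHS]big_mkcond; apply: eq_bigr => m _.
rewrite big_split /= -natr_prod prodrXr mulr_natl coefMn coef_signX.
by case: eqP => _; rewrite ?mul0rn ?mulr_natr.
Qed.

Lemma prod_iota1 (R : comNzRingType) n (F : nat -> R) :
  \prod_(k < n) F k.+1 = \prod_(i <- iota 1 n) F i.
Proof.
rewrite -(big_mkord xpredT (fun k => F k.+1)) /index_iota subn0.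
by rewrite (iotaDl 1 0) big_map.
Qed.

(** * The generating function as a quotient of theta series *)

Section OverGF.
Variables (l N : nat).
Hypotheses (l_odd : odd l).
Local Notation q := (- 'X : {poly 'F_5}).

Lemma eqcoef_prod1 (e : {poly 'F_5}) (s : seq nat) (P : pred nat) :
  (forall k, P k -> (N < k)%N) -> eqcoef N (\prod_(k <- s | P k) (1 + e * q ^+ k)) 1.
Proof.
move=> h; have := @eqcoef_prod _ N _ s P (fun k => 1 + e * q ^+ k) (fun=> 1).
rewrite big1_eq; apply=> k /h Nk; rewrite -[X in eqcoef N _ X]addr0.
by apply: eqcoefD => //; rewrite mulrC; apply: eqcoef_signX.
Qed.

(** With q = -X, a truncation of (q^c; q^c) for e = -1 and of (-q^c; q^c) for e = 1. *)
Definition qprod (e : {poly 'F_5}) (c : nat) : {poly 'F_5} :=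
  \prod_(k < N) (1 + e * (q ^+ c) ^+ k.+1).

(** The right side has further factors, but their exponents exceed [N]. *)
Lemma prod_multiples (e : {poly 'F_5}) :
  eqcoef N (\prod_(i <- iota 1 N | (l %| i)%N) (1 + e * q ^+ i))
           (qprod e l).
Proof.
have l0 : (0 < l)%N by case: (l) l_odd.
rewrite /qprod (prod_iota1 N (fun k => 1 + e * (q ^+ l) ^+ k)).
rewrite [X in eqcoef N _ X](eq_bigr (fun k => 1 + e * q ^+ (l * k))); last first.
  by move=> k _; rewrite exprM.
rewrite -(big_map (muln l) xpredT (fun k => 1 + e * q ^+ k)).
rewrite [X in eqcoef N _ X](bigID (fun k => k <= N)%N) /=.
rewrite -[X in eqcoef N X _]mulr1; apply: eqcoefM; last first.
  by apply: eqcoef_sym; apply: eqcoef_prod1 => k; rewrite ltnNge.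
rewrite -big_filter -[X in eqcoef N _ X]big_filter.
rewrite (perm_big [seq k <- [seq (l * i)%N | i <- iota 1 N] | (k <= N)%N]) //.
apply: uniq_perm; rewrite ?filter_uniq ?iota_uniq ?map_inj_uniq ?iota_uniq //.
  by move=> a b /eqP; rewrite eqn_pmul2l // => /eqP.
move=> k; rewrite !mem_filter mem_iota add1n ltnS; apply/and3P/andP.
  move=> [/dvdnP[c ->] h1 h2]; split=> //; apply/mapP; exists c; rewrite 1?mulnC //.
  by rewrite mem_iota; nia.
move=> [kN /mapP[c]]; rewrite mem_iota => h e1; subst k.
by rewrite dvdn_mulr //; split=> //; nia.
Qed.

(** In Shanks' sum only the term s = 0 survives; the others are divisible by q^(c(N+1)). *)
Lemma theta_gauss c : odd c ->
  eqcoef N (theta N c * qprod 1 c) (qprod (-1) c).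
Proof.
move=> oc; have c0 : (0 < c)%N by case: (c) oc.
have -> : qprod 1 c = \prod_(k < N) (1 + (q ^+ c) ^+ k.+1).
  by apply: eq_bigr => k _; rewrite mul1r.
have -> : qprod (-1) c = \prod_(k < N) (1 - (q ^+ c) ^+ k.+1).
  by apply: eq_bigr => k _; rewrite mulN1r.
rewrite theta_partialE // shanks big_ord_recl.
rewrite -[X in eqcoef N _ X]addr0; apply: eqcoefD.
  by rewrite expr0 mul0n expr0 !mul1r big_ord0 mul1r big_mkord.
apply: eqcoef_sum0 => s _; rewrite -!mulrA mulrCA -exprM.
by apply: eqcoef_signX; rewrite /= /bump /=; nia.
Qed.

(** The left factor is the product of (1 + q^i) / (1 - q^i) over the [i] not divisible by [l].
    Denominators are cleared by multiplying with [qprod 1 1 * qprod 1 l], and Gauss' identity is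
    used for c = 1 and c = l. *)
Lemma overgf_theta : eqcoef N (overgf l N * theta N 1) (theta N l).
Proof.
have l0 : (0 < l)%N by case: (l) l_odd.
have D0 c : (0 < c)%N -> (qprod 1 c)`_0 = 1.
  move=> c0; rewrite coef0_prod big1 // => k _.
  by rewrite coefD coef1 mul1r -exprM coef0_signX ?addr0 // muln_gt0 c0.
pose T i : {poly 'F_5} := \sum_(j < N.+1) (weight l i j)%:R * q ^+ (i * j).
have T0 i : (l %| i)%N -> T i = 1.
  move=> li; rewrite /T big_ord_recl big1 ?addr0 ?muln0 ?mulr1 // => j _.
  by rewrite /weight li /= mul0r.
have T1 i : ~~ (l %| i)%N -> eqcoef N (T i * (1 - q ^+ i)) (1 + q ^+ i).
  move=> li; have i0 : (0 < i)%N by case: (i) li; rewrite ?dvdn0.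
  (* The factor is 1 + 2x + ... + 2x^N with x = q^i, so the truncation error is exactly -2
     x^(N+1). *)
  have -> : T i * (1 - q ^+ i) = 1 + q ^+ i + q ^+ (i * N.+1) * (- 2).
    rewrite /T; elim: (N) => [|n IH].
      by rewrite big_ord_recl big_ord0 /weight /= muln0 muln1; ring.
    rewrite big_ord_recr mulrDl IH /weight /= (negPf li) (mulnS i n.+1).
    by rewrite !exprD; ring.
  rewrite -[X in eqcoef N _ X]addr0; apply: eqcoefD => //.
  by apply: eqcoef_signX; nia.
have PE : overgf l N = \prod_(i <- iota 1 N | ~~ (l %| i)%N) T i.
  rewrite /overgf big_ord_recl -/(T 0%N) T0 ?dvdn0 // mul1r.
  rewrite (eq_bigr (fun i : 'I_N => T i.+1)) //.
  rewrite (prod_iota1 N T) (bigID (fun i => l %| i)%N) /= big1 ?mul1r //.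
pose res e : {poly 'F_5} := \prod_(i <- iota 1 N | ~~ (l %| i)%N) (1 + e * q ^+ i).
have splitq e : eqcoef N (qprod e 1) (qprod e l * res e).
  rewrite /qprod expr1 (prod_iota1 N (fun i => 1 + e * q ^+ i)).
  by rewrite (bigID (fun i => l %| i)%N) /=; apply: eqcoefM => //; apply: prod_multiples.
have Pres : eqcoef N (overgf l N * res (-1)) (res 1).
  rewrite PE -big_split; apply: eqcoef_prod => i /T1.
  by rewrite mulN1r mul1r.
apply: (@eqcoef_cancel _ _ (qprod 1 1 * qprod 1 l)).
  by rewrite coef0M !D0 ?mulr1.
have -> : overgf l N * theta N 1 * (qprod 1 1 * qprod 1 l) =
  overgf l N * qprod 1 l * (theta N 1 * qprod 1 1) by ring.
apply: eqcoef_trans (eqcoefM (@eqcoef_refl _ _ _) (@theta_gauss 1 isT)) _.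
apply: eqcoef_trans (eqcoefM (@eqcoef_refl _ _ _) (splitq _)) _.
have -> : overgf l N * qprod 1 l * (qprod (-1) l * res (-1)) =
  (overgf l N * res (-1)) * qprod 1 l * qprod (-1) l by ring.
have -> : theta N l * (qprod 1 1 * qprod 1 l) = 
  qprod 1 1 * (theta N l * qprod 1 l) by ring.
apply: eqcoefM; last by apply: eqcoef_sym; exact: theta_gauss.
apply: eqcoef_trans (eqcoefM Pres (@eqcoef_refl _ _ _)) _.
by rewrite mulrC; apply: eqcoef_sym.
Qed.
End OverGF.

(** Three applications of U move the exponent 125t to t. The factor 625 leaves phi(X^(5l)) after
    them, a series in X^5, as [theta_vanish] requires. *)
Lemma Abar_125 l t : odd l -> (t %% 5 == 1)%N || (t %% 5 == 4)%N ->
  (5 %| Abar (625 * l) (125 * t))%N.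
Proof.
move=> ol rt; pose N := (125 * t)%N; pose P := overgf (625 * l) N.
pose th := theta N; pose phi := th 1%N.
have phi5 : th 5%N = phi \Po 'X^5 by rewrite theta_comp.
have h0 : eqcoef N (P * phi) (th (125 * l)%N \Po 'X^5).
  by rewrite theta_comp mulnA; apply: overgf_theta; rewrite oddM.
have h1 : eqcoef (25 * t) (sect5 P) (th (125 * l)%N * phi ^+ 3).
  (* Multiplying [h0] by [phi ^+ 4] creates phi^5 = phi(X^5), which leaves U as the factor [phi]
     cancelled here. *)
  apply: (@eqcoef_cancel _ _ phi); first by rewrite theta_coef0.
  have := eqcoefM h0 (@eqcoef_refl _ N (phi ^+ 4)).
  have -> : P * phi * phi ^+ 4 = P * (phi ^+ 5) by ring.
  rewrite theta_exp5 -/(th 5%N) phi5 mulrC [X in eqcoef _ _ X]mulrC => h.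
  have {}h : eqcoef (5 * (25 * t)) ((phi \Po 'X^5) * P)
      (phi ^+ 4 * (th (125 * l)%N \Po 'X^5)).
    by rewrite mulnA.
  move/eqcoef_sect5: h; rewrite mulrC !sect5_mul_comp => h.
  apply: eqcoef_trans h _.
  have -> : th (125 * l)%N * phi ^+ 3 * phi = phi ^+ 4 * th (125 * l)%N by ring.
  by apply: eqcoefM => //; apply: sect5_theta4; rewrite mulnA.
have h2 : eqcoef (5 * t) (sect5 (sect5 P)) (th (25 * l)%N * (th 5%N * phi ^+ 2)).
  have e : th (125 * l)%N = th (25 * l)%N \Po 'X^5 by rewrite theta_comp mulnA.
  have := @eqcoef_sect5 _ (5 * t) (sect5 P) (th (125 * l)%N * phi ^+ 3).
  rewrite mulnA => /(_ h1) h; apply: eqcoef_trans h _.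
  rewrite e mulrC sect5_mul_comp mulrC; apply: eqcoefM => //.
  by apply: sect5_theta3; rewrite /N; lia.
have h3 : eqcoef t (sect5 (sect5 (sect5 P)))
    (th (5 * l)%N * (phi * (2 * phi ^+ 2 - th 5%N ^+ 2))).
  have e : th (25 * l)%N = th (5 * l)%N \Po 'X^5 by rewrite theta_comp mulnA.
  apply: eqcoef_trans (eqcoef_sect5 h2) _.
  have -> : th (25 * l)%N * (th 5%N * phi ^+ 2) =
      phi ^+ 2 * ((phi * th (5 * l)%N) \Po 'X^5).
    by rewrite rmorphM /= -phi5 -e; ring.
  rewrite sect5_mul_comp mulrC -mulrA mulrCA; apply: eqcoefM => //; apply: eqcoefM => //.
  by apply: sect5_theta2; rewrite /N; lia.
have char5 : 5 \in [pchar 'F_5] by rewrite pchar_Fp.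
rewrite (dvdn_pcharf char5).
have := h3 t (leqnn t); rewrite !coef_sect5.
have -> : (5 * (5 * (5 * t)) = N)%N by rewrite /N; lia.
rewrite coef_overgf -/N.
have -> : th (5 * l)%N = th l \Po 'X^5 by rewrite theta_comp.
rewrite theta_vanish //; last by rewrite /N; lia.
by move/eqP; rewrite mulf_eq0 signr_eq0.
Qed.

Local Close Scope ring_scope.

Theorem theorem9 (n alpha : nat) (halpha : 4 <= alpha) :
  Abar (5 ^ alpha) (625 * n + 125) = 0 %[mod 5] /\
  Abar (5 ^ alpha) (625 * n + 500) = 0 %[mod 5].
Proof.
have -> : 5 ^ alpha = 625 * 5 ^ (alpha - 4) by rewrite -{1}(subnKC halpha) expnD.
have o5 : odd (5 ^ (alpha - 4)) by rewrite oddX orbT.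
(* The two progressions are 125t with t = 1 and t = 4 mod 5. *)
have -> : 625 * n + 125 = 125 * (5 * n + 1) by lia.
have -> : 625 * n + 500 = 125 * (5 * n + 4) by lia.
by split; apply/eqP; rewrite mod0n; apply: Abar_125 => //; lia.
Qed.
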